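(* Let $t\ge1$ be an integer, let $G$ be a connected graph on $n$ vertices, and let $D$ be its distance matrix, with eigenvalues $\tilde\lambda_1\ge\cdots\ge\tilde\lambda_n$ (with multiplicity). Then $$\mathrm{eq}_t(G)\le \bigl|\{i:\tilde\lambda_i\le -t\}\bigr|+1.$$
   Context: Graphs are finite, simple and undirected; $d(u,v)$ is the shortest-path distance, and the distance matrix $D$ has entries $D_{uv}=d(u,v)$. A set $S\subseteq V(G)$ is $t$-equidistant if $d(u,v)=t$ for all distinct $u,v\in S$, and $\mathrm{eq}_t(G)$ is the maximum size of a $t$-equidistant set of $G$. *)

(* Defs.v *)
From HB Require Import structures.
From mathcomp Require Import all_boot all_order all_algebra.

Set Implicit Arguments.
Unset Strict Implicit.
Unset Printing Implicit Defensive.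

Import Order.TTheory GRing.Theory Num.Theory.

(* The least k < #|T| such that some walk of length k goes from u to v.  Since
   nth 0 (iota 0 n) k = k for k < n, the position returned by find is the
   length itself.  In a connected graph every distance is < #|T|; the value at
   an unreachable pair is #|T|. *)
Definition dist (T : finType) (e : rel T) (u v : T) : nat :=
  find (fun k => [exists p : k.-tuple T, path e u p && (last u p == v)])
       (iota 0 #|T|).

Definition equidistant (T : finType) (e : rel T) (t : nat) (S : {set T}) : bool :=
  [forall u in S, forall v in S, (u != v) ==> (dist e u v == t)].

Definition eq_num (T : finType) (e : rel T) (t : nat) : nat :=
  \max_(S : {set T} | equidistant e t S) #|S|.

Definition distance_matrix (R : nzRingType) (T : finType) (e : rel T) :
    'M[R]_#|T| :=
  (\matrix_(i, j) (dist e (enum_val i) (enum_val j))%:R)%R.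

(* Algebraic multiplicities: each value occurs as often as it is a root of the
   characteristic polynomial. *)
Definition ordered_eigenvalues (R : rcfType) (n : nat) (A : 'M[R]_n)
    (lambda : 'I_n -> R) : Prop :=
  (forall i j : 'I_n, (i <= j)%N -> (lambda j <= lambda i)%R) /\
  char_poly A = (\prod_(i < n) ('X - (lambda i)%:P))%R.

(* Main.v *)
(** On vectors supported on a t-equidistant set S and summing to zero, the
    quadratic form of the distance matrix is -t times the squared norm, because
    the block of D indexed by S is t(J - I).  This space has dimension at least
    |S| - 1, and it meets trivially the span of the eigenvectors of D with
    eigenvalue > -t.  Diagonalization is done over R[i], where the spectral
    theorem for Hermitian matrices is available. *)

Require Import Defs.
From HB Require Import structures.
From mathcomp Require Import all_boot all_order all_algebra.
From mathcomp Require Import spectral sesquilinear.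
From mathcomp Require Import complex ring.

Set Implicit Arguments.
Unset Strict Implicit.
Unset Printing Implicit Defensive.

Import Order.TTheory GRing.Theory Num.Theory.

Local Open Scope ring_scope.
Local Open Scope sesquilinear_scope.
Local Open Scope complex_scope.

(** Reversing a walk keeps its length, so both searches test equivalent predicates at every [k]. *)
Lemma dist_sym (T : finType) (e : rel T) (u v : T) :
  symmetric e -> dist e u v = dist e v u.
Proof.
move=> e_sym; apply: eq_find => k.
suff walk_rev x y : [exists p : k.-tuple T, path e x p && (last x p == y)] ->
    [exists p : k.-tuple T, path e y p && (last y p == x)].
  by apply/idP/idP; apply: walk_rev.
case/existsP=> p /andP[ep /eqP <-].
have sz_rev : size (rev (belast x p)) == k.
  by rewrite size_rev size_belast size_tuple.
apply/existsP; exists (Tuple sz_rev); apply/andP; split => /=.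
  by rewrite rev_path -(@eq_path _ e) // => a b; apply: e_sym.
by case: (tval p) => //= a s; rewrite rev_cons last_rcons.
Qed.

Lemma dist_refl (T : finType) (e : rel T) (u : T) : dist e u u = 0%N.
Proof.
(* Since [u] inhabits [T], the search range is nonempty and starts at [0], where the empty walk
   succeeds. *)
rewrite /dist; have : (0 < #|T|)%N by apply/card_gt0P; exists u.
case: #|T| => //= n _; case: ifP => // /existsP[].
by exists [tuple] => /=; rewrite eqxx.
Qed.

(** [P] commutes with the scalar matrix ['X], hence intertwines the two characteristic matrices; its
    nonzero determinant then cancels. *)
Lemma char_poly_similar (F : fieldType) (n : nat) (P A B : 'M[F]_n) :
  P \in unitmx -> P *m A = B *m P -> char_poly A = char_poly B.
Proof.
move=> Punit PA; pose Q := map_mx polyC P.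
have QA : Q *m char_poly_mx A = char_poly_mx B *m Q.
  by rewrite mulmxBr mulmxBl -!map_mxM PA scalar_mxC.
have detQ : \det Q != 0.
  by rewrite det_map_mx polyC_eq0 -unitfE -unitmxE.
by apply: (mulfI detQ); rewrite /char_poly -det_mulmx QA det_mulmx mulrC.
Qed.

Lemma char_poly_spectral (C : numClosedFieldType) (n : nat) (A : 'M[C]_n) :
  A \is normalmx ->
  char_poly A = \prod_(i < n) ('X - (spectral_diag A 0 i)%:P).
Proof.
move=> /orthomx_spectralP A_eq.
have -> : char_poly A = char_poly (diag_mx (spectral_diag A)).
  apply: (char_poly_similar (spectral_unit A)).
  by rewrite {2}A_eq !mulmxA mulmxV ?spectral_unit // mul1mx.
rewrite char_poly_trig ?diag_mx_is_trig //.
by apply: eq_bigr => i _; rewrite mxE eqxx mulr1n.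
Qed.

(** The counting half of the Courant-Fischer principle: [U] is disjoint from the span of the
    eigenvectors with eigenvalue above [c], so the two dimensions add up to at most [n]. *)
Lemma rank_le_spectral_diag (C : numClosedFieldType) (m n : nat)
    (A : 'M[C]_n) (U : 'M[C]_(m, n)) (c : C) :
  A \is hermsymmx -> c \is Num.real ->
  (forall x : 'rV_n, (x <= U)%MS ->
    (x *m A *m x^t*) 0 0 <= c * (x *m x^t*) 0 0) ->
  (\rank U <= #|[set i | (spectral_diag A 0 i <= c)%R]|)%N.
Proof.
move=> A_herm c_real Uc.
have /orthomx_spectralP A_eq := hermitian_normalmx A_herm.
have d_real i : spectral_diag A 0 i \is Num.real.
  exact: mxOverP (hermitian_spectral_diag_real A_herm) 0 i.
pose B := ~: [set i | spectral_diag A 0 i <= c].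
pose f (i : 'I_#|B|) : 'I_n := enum_val i.
set P := spectralmx A in A_eq; set d := spectral_diag A in A_eq d_real B f *.
have /unitarymxP PP1 : P \is unitarymx := spectral_unitarymx A.
rewrite invmx_unitary ?spectral_unitarymx // in A_eq.
pose V := rowsub f P.
pose D : 'rV_#|B| := \row_i d 0 (f i).
have f_inj : injective f := enum_val_inj.
have VconjE : V^t* = colsub f (P^t*) by rewrite trmx_mxsub map_mxsub.
have VV1 : V *m V^t* = 1%:M.
  rewrite VconjE -mxsub_mul PP1; apply/matrixP => i j.
  by rewrite !mxE (inj_eq f_inj).
have VAV : V *m A *m V^t* = diag_mx D.
  rewrite VconjE -(mxsub_id A) -mxsub_mul.
  rewrite -mxsub_mul A_eq !mulmxA PP1 mul1mx -mulmxA PP1 mulmx1.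
  by apply/matrixP => i j; rewrite !mxE (inj_eq f_inj).
have rankV : \rank V = #|B| by apply: mxrank_unitary; apply/unitarymxP.
(* [V] spans the eigenvectors with eigenvalue > c, where the form exceeds
   [c] times the squared norm. *)
suff cap0 : (U :&: V)%MS = 0.
  have := mxrank_sum_cap U V; rewrite cap0 mxrank0 addn0 rankV => rankUV.
  by rewrite -(leq_add2r #|B|) -rankUV cardsC card_ord rank_leq_col.
apply/eqP/rowV0P => x; rewrite sub_capmx => /andP[/Uc xc /submxP[y x_eq]].
move: xc; rewrite x_eq trmx_mul map_mxM !mulmxA.
rewrite -(mulmxA y V (V^t*)) VV1 mulmx1 -(mulmxA y V A) -(mulmxA y _ (V^t*)) VAV.
rewrite !mxE mulr_sumr -subr_ge0 -sumrB => le0.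
have term_le0 i : c * (y 0 i * y^t* i 0) - (y *m diag_mx D) 0 i * y^t* i 0 =
    - ((D 0 i - c) * `|y 0 i| ^+ 2).
  by rewrite mul_mx_diag !mxE normCK; ring.
(* The order on [C] is partial: turning the failure of [<= c] into [> c] relies on both numbers
   being real. *)
have gap_gt0 i : 0 < D 0 i - c.
  rewrite mxE subr_gt0 real_ltNge //.
  by have := enum_valP i; rewrite !inE.
rewrite (eq_bigr _ (fun i _ => term_le0 i)) sumrN oppr_ge0 in le0.
have y_eq0 : y = 0.
  have term_ge0 i : 0 <= (D 0 i - c) * `|y 0 i| ^+ 2.
    by rewrite mulr_ge0 ?exprn_ge0 // ltW.
  have /eqP := le_anti (introT andP (conj le0 (sumr_ge0 _ (fun i _ => term_ge0 i)))).
  rewrite psumr_eq0 => [/allP y0|i _]; last exact: term_ge0.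
  apply/rowP => i; rewrite [RHS]mxE; apply/eqP.
  have := y0 i (mem_index_enum i).
  by rewrite mulf_eq0 (gt_eqF (gap_gt0 i)) sqrf_eq0 normr_eq0.
by rewrite y_eq0 mul0mx.
Qed.

(** Transfers the count from [R[i]] back to [R]: both families split the same characteristic
    polynomial, and linear factors are unique up to permutation. *)
Lemma count_spectral_diag (R : rcfType) (n : nat) (A : 'M[R]_n)
    (lambda : 'I_n -> R) (c : R) :
  map_mx (real_complex R) A \is normalmx ->
  char_poly A = \prod_(i < n) ('X - (lambda i)%:P) ->
  #|[set i | spectral_diag (map_mx (real_complex R) A) 0 i <= c%:C]| =
  #|[set i | lambda i <= c]|.
Proof.
set AC := map_mx _ A => AC_normal charA.
pose dC i := spectral_diag AC 0 i.
have : \prod_(z <- map dC (index_enum 'I_n)) ('X - z%:P) =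
       \prod_(z <- map (fun i => (lambda i)%:C) (index_enum 'I_n)) ('X - z%:P).
  rewrite !big_map -(char_poly_spectral AC_normal).
  rewrite /AC -map_char_poly charA rmorph_prod.
  by apply: eq_bigr => i _; rewrite /= map_polyXsubC.
move=> /prod_XsubC_eq/permP/(_ (fun z => z <= c%:C)).
rewrite !count_map => eq_cnt.
have cardE_index (P : pred 'I_n) : #|[set i | P i]| = count P (index_enum 'I_n).
  by rewrite -sum1dep_card sum1_count.
rewrite !cardE_index eq_cnt.
by apply: eq_count => i /=; rewrite lecR.
Qed.

Theorem theorem24 (R : rcfType) (t : nat) (ht : (1 <= t)%N)
    (T : finType) (e : rel T)
    (e_sym : symmetric e) (e_irr : irreflexive e)
    (e_conn : forall u v : T, connect e u v)
    (lambda : 'I_#|T| -> R)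
    (hlambda : ordered_eigenvalues (distance_matrix R e) lambda) :
  (eq_num e t <= #|[set i : 'I_#|T| | (lambda i <= - t%:R)%R]| + 1)%N.
Proof.
apply/bigmax_leqP => S /forall_inP S_eq.
have [_ charD] := hlambda.
set D := distance_matrix R e in charD.
pose A := map_mx (real_complex R) D.
have A_herm : A \is hermsymmx.
  apply: realsym_hermsym.
    apply/is_hermitianmxP; rewrite expr0 scale1r map_mx_id //.
    by apply/matrixP => i j; rewrite !mxE dist_sym.
  apply/mxOverP => i j; rewrite !mxE rmorph_nat; exact: realn.
rewrite -(count_spectral_diag _ (hermitian_normalmx A_herm) charD).
rewrite rmorphN rmorph_nat -/A.
pose g (i : 'I_#|S|) : 'I_#|T| := enum_rank (enum_val i).
have g_inj : injective g by move=> i j /enum_rank_inj/enum_val_inj.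
(* The rows of [E] are the standard basis vectors at the vertices of [S]: [y *m E] extends [y] by
   zero, and [E *m A *m E^t*] is the block of [A] on [S]. *)
pose E : 'M[R[i]]_(#|S|, #|T|) := rowsub g 1%:M.
have EconjE : E^t* = colsub g 1%:M.
  by rewrite trmx_mxsub map_mxsub trmx1 map_mx1.
have EE1 : E *m E^t* = 1%:M.
  rewrite EconjE -mxsub_mul mulmx1; apply/matrixP => i j.
  by rewrite !mxE (inj_eq g_inj).
(* [u *m u^T] is the all-ones matrix [J], and [y *m u = 0] says that the coordinates of [y] sum to
   zero. *)
pose u : 'cV[R[i]]_#|S| := const_mx 1.
have EAE : E *m A *m E^t* = t%:R *: (u *m u^T) - t%:R *: 1%:M.
  rewrite EconjE -(mxsub_id A) -mxsub_mul -mxsub_mul mulmx1 mul1mx.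
  apply/matrixP => i j; rewrite !mxE big_ord1 !mxE mulr1 rmorph_nat !enum_rankK.
  have [->|ij] := eqVneq i j; first by rewrite dist_refl mulr1 subrr.
  rewrite mulr0 subr0 mulr1; congr _%:R; apply/eqP.
  have /forall_inP/(_ _ (enum_valP j))/implyP := S_eq _ (enum_valP i).
  by apply; rewrite (inj_eq enum_val_inj).
have E_free : row_free E.
  by rewrite -row_leq_rank mxrank_unitary //; apply/unitarymxP.
(* [u] has one column, so its kernel loses at most one dimension, and [E] is injective. Truncated
   subtraction covers an empty [S]. *)
have rankU : (#|S| - 1 <= \rank (kermx u *m E))%N.
  by rewrite mxrankMfree // mxrank_ker leq_sub2l ?rank_leq_col.
rewrite addnC -leq_subLR; apply: leq_trans rankU _.
apply: rank_le_spectral_diag => // [|x].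
  by rewrite realN realn.
case/submxP => z ->; rewrite mulmxA; set y := z *m _.
have yu0 : y *m u = 0 by rewrite -mulmxA mulmx_ker mulmx0.
rewrite trmx_mul map_mxM !mulmxA.
rewrite -(mulmxA y E (E^t*)) EE1 mulmx1 -(mulmxA y E A) -(mulmxA y _ (E^t*)) EAE.
(* The [J] term dies by [yu0], leaving [- t] times the squared norm of [y]. *)
rewrite mulmxBr -!scalemxAr mulmxA yu0 mul0mx scaler0 sub0r mulmx1.
by rewrite mulNmx -scalemxAl !mxE mulNr.
Qed.
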